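(* Let $\Omega\in\mathcal B(\mathbb R^n)$, let $C\subset\overline\Omega$ be a density set of $\Omega$, and let $\mu\in\mathrm{Dens}_C$ be a density measure at $C$. Then $$\lim_{\delta\downarrow0}\operatorname*{ess\,inf}_{C_\delta\cap\Omega}f\ \le\ \int_\Omega f\,d\mu\ \le\ \lim_{\delta\downarrow0}\operatorname*{ess\,sup}_{C_\delta\cap\Omega}f\qquad\text{for all }f\in L^\infty(\Omega).$$
   Context: $\mathcal L^n$ is Lebesgue measure on $\mathbb R^n$, $\mathcal B(\Omega)$ the Borel subsets of $\Omega$, $L^\infty(\Omega)=L^\infty(\Omega,\mathcal B(\Omega),\mathcal L^n)$; essential suprema and infima are with respect to $\mathcal L^n$. A measure on $\Omega$ means a finitely additive set function on $\mathcal B(\Omega)$ vanishing at $\emptyset$. $\mathrm{ba}(\Omega,\mathcal B(\Omega),\mathcal L^n)$ is the space of bounded real-valued finitely additive measures $\mu$ on $\mathcal B(\Omega)$ such that $\mu(A)=0$ whenever $\mathcal L^n(A)=0$; it is the dual of $L^\infty(\Omega)$ via $f\mapsto\int_\Omega f\,d\mu$. $C_\delta$ denotes the open $\delta$-neighborhood of $C$ in $\mathbb R^n$. A set $C\subset\overline\Omega$ is a density set of $\Omega$ if $C$ is nonempty and closed in $\mathbb R^n$, $\mathcal L^n(C\cap\Omega)=0$, and $\mathcal L^n(C_\delta\cap\Omega)>0$ for all $\delta>0$. $\mathrm{Dens}_C$ is the set of density measures at $C$, i.e. of all $\mu\in\mathrm{ba}(\Omega,\mathcal B(\Omega),\mathcal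 L^n)$ with $\mu\ge 0$ and $\mu(C_\delta\cap\Omega)=\mu(\Omega)=1$ for all $\delta>0$. *)

(* Defs.v *)
From HB Require Import structures.
From mathcomp Require Import all_boot all_order all_algebra.
From mathcomp Require Import all_classical all_reals all_analysis.
From mathcomp Require Import measurable_realfun ess_sup_inf.

Set Implicit Arguments.
Unset Strict Implicit.
Unset Printing Implicit Defensive.
Import Order.TTheory GRing.Theory Num.Theory.
Import numFieldNormedType.Exports.
Import HBSimple.

Local Open Scope classical_set_scope.
Local Open Scope ring_scope.

Section borel.
Context {R : realType} {n : nat}.

HB.instance Definition _ :=
  @isMeasurable.Build (sigma_display (@open 'rV[R]_n)) 'rV[R]_n
    <<s (@open 'rV[R]_n) >>
    (@sigma_algebra0 _ setT _) (@sigma_algebraC _ _)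
    (@sigma_algebra_bigcup _ setT _).

Lemma open_measurable_rV (U : set 'rV[R]_n) : open U -> measurable U.
Proof. exact: sub_sigma_algebra. Qed.

End borel.

Lemma sigma_finite_prod d1 d2 (T1 : measurableType d1)
    (T2 : measurableType d2) (R : realType)
    (m1 : {sigma_finite_measure set T1 -> \bar R})
    (m2 : {sigma_finite_measure set T2 -> \bar R}) :
  sigma_finite setT (m1 \x m2)%E.
Proof.
have /sigma_finiteP[F [TF ndF Foo]] := sigma_finiteT m1.
have /sigma_finiteP[G [TG ndG Goo]] := sigma_finiteT m2.
exists (fun n => F n `*` G n).
  rewrite -setXTT TF TG predeqE => -[x y]; split.
    move=> [/= [n _ Fnx] [k _ Gky]]; exists (maxn n k) => //; split.
    - by move: x Fnx; exact/subsetPset/ndF/leq_maxl.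
    - by move: y Gky; exact/subsetPset/ndG/leq_maxr.
  by move=> [n _ []/= ? ?]; split; exists n.
move=> k; have [? ?] := Foo k; have [? ?] := Goo k.
split; first exact: measurableX.
by rewrite product_measure1E// lte_mul_pinfty// ge0_fin_numE.
Qed.

Section lebesgue_cons.
Context {R : realType} {n : nat}.
Variable L : {sigma_finite_measure set (n.-tuple (measurableTypeR R)) -> \bar R}.

Let pair_cons (p : measurableTypeR R * n.-tuple (measurableTypeR R)) :
    n.+1.-tuple (measurableTypeR R) := [tuple of p.1 :: p.2].
Let uncons (t : n.+1.-tuple (measurableTypeR R)) :
    measurableTypeR R * n.-tuple (measurableTypeR R) :=
  (thead t, [tuple of behead t]).

Let measurable_pair_cons : measurable_fun [set: _] pair_cons.
Proof. exact: measurable_cons. Qed.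

Let measurable_uncons : measurable_fun [set: _] uncons.
Proof.
by apply: measurable_fun_pair; [exact: measurable_tnth|exact: measurable_behead].
Qed.

Let pair_consK : cancel pair_cons uncons.
Proof. by move=> [x t]; congr pair; apply/val_inj. Qed.

Local Notation mpair := (@lebesgue_measure R \x L)%E.

Definition lebesgue_cons : set (n.+1.-tuple (measurableTypeR R)) -> \bar R :=
  pushforward mpair (fun p => [tuple of p.1 :: p.2]).

Let lebesgue_cons0 : lebesgue_cons set0 = 0%E.
Proof. exact: (measure0 mpair). Qed.

Let lebesgue_cons_ge0 A : (0 <= lebesgue_cons A)%E.
Proof. exact: measure_ge0. Qed.

Let lebesgue_cons_sigma_additive : semi_sigma_additive lebesgue_cons.
Proof.
move=> F mF tF mUF; rewrite /lebesgue_cons /pushforward preimage_bigcup.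
apply: measure_semi_sigma_additive.
- by move=> i; rewrite -[X in measurable X]setTI; exact: measurable_pair_cons.
- apply/trivIsetP => /= i j _ _ ij; rewrite -preimage_setI.
  by move/trivIsetP : tF => /(_ _ _ _ _ ij) ->//; rewrite preimage_set0.
- by rewrite -preimage_bigcup -[X in measurable X]setTI;
    exact: measurable_pair_cons.
Qed.

HB.instance Definition _ := isMeasure.Build _ _ _ lebesgue_cons
  lebesgue_cons0 lebesgue_cons_ge0 lebesgue_cons_sigma_additive.

Let lebesgue_cons_sigma_finite : sigma_finite setT lebesgue_cons.
Proof.
have [F TF Foo] := sigma_finite_prod (@lebesgue_measure R) L.
exists (fun i => uncons @^-1` F i).
  by rewrite -preimage_bigcup -TF preimage_setT.
move=> k; have [mFk Fkoo] := Foo k; split.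
  by rewrite -[X in measurable X]setTI; exact: measurable_uncons.
rewrite /lebesgue_cons /pushforward -comp_preimage.
by rewrite (_ : uncons \o _ = id)//; apply/funext; exact: pair_consK.
Qed.

HB.instance Definition _ := Measure_isSigmaFinite.Build _ _ _ lebesgue_cons
  lebesgue_cons_sigma_finite.

End lebesgue_cons.

(* n-fold product of lebesgue_measure. *)
Fixpoint lebesgue_tuple (R : realType) (n : nat) :
    {sigma_finite_measure set (n.-tuple (measurableTypeR R)) -> \bar R} :=
  if n is m.+1 then lebesgue_cons (lebesgue_tuple R m)
  else \d_([tuple] : 0.-tuple (measurableTypeR R)).

Lemma lebesgue_tuple_box (R : realType) (n : nat)
    (B : 'I_n -> set (measurableTypeR R)) : (forall i, measurable (B i)) ->
  lebesgue_tuple R n [set t | forall i, B i (tnth t i)] =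
  (\prod_(i < n) lebesgue_measure (B i))%E.
Proof.
elim: n => [|n IH] in B *; move=> mB.
  by rewrite big_ord0/= /dirac indicE mem_set// => -[].
rewrite big_ord_recl -IH => [|i]; last exact: mB.
rewrite -product_measure1E//; last first.
  rewrite (_ : mkset _ = \bigcap_(i in setT)
    ((@tnth n (measurableTypeR R) ^~ i) @^-1` B (lift ord0 i))); last first.
    by apply/seteqP; split=> t/= h i; [move=> _|]; exact: h.
  apply: fin_bigcap_measurable => // i _.
  by rewrite -[X in measurable X]setTI; exact: measurable_tnth.
rewrite /= /lebesgue_cons /pushforward; congr (product_measure1 _ _ _).
apply/seteqP; split=> -[x t] /=.
  move=> h; split; first exact: (h ord0).
  by move=> i; have := h (lift ord0 i); rewrite tnthS.
move=> [h0 h] i; case: (unliftP ord0 i) => [j ->|->]; last exact: h0.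
by rewrite tnthS; exact: h.
Qed.

Section lebesgue_rV.
Context {R : realType} {n : nat}.

Definition row_of_tuple (t : n.-tuple (measurableTypeR R)) : 'rV[R]_n :=
  \row_i tnth t i.

Lemma measurable_row_of_tuple : measurable_fun [set: _] row_of_tuple.
Proof.
apply: (@measurability _ _ _ _ setT row_of_tuple (@open 'rV[R]_n)) => //.
move=> _ [U oU <-]; rewrite setTI.
pose box (p : n.-tuple rat * nat) : set 'rV[R]_n :=
  ball (\row_i ratr (tnth p.1 i) : 'rV[R]_n) (p.2.+1%:R^-1).
have -> : U = \bigcup_(p in [set p | box p `<=` U]) box p.
  apply/seteqP; split=> [x Ux|x [p pU xp]]; last exact: pU.
  have /nbhs_ballP[_/posnumP[e] xeU] : nbhs x U by exact: open_nbhs_nbhs.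
  have [k ke] : exists k, k.+1%:R^-1 < e%:num / 2.
    have e20 : 0 < e%:num / 2 by [].
    by exists (Num.truncn (e%:num / 2)^-1); rewrite invf_plt ?posrE// truncnS_gt.
  have q_ i : {q : rat | ball (x 0 i) (k.+1%:R^-1) (ratr q)}.
    apply: cid; have : x 0 i - k.+1%:R^-1 < x 0 i + k.+1%:R^-1.
      by rewrite ltrD2l gtrN.
    move=> /rat_in_itvoo[q]; rewrite in_itv/= => /andP[q1 q2]; exists q.
    by rewrite /ball/= distrC ltr_distl q1 q2.
  pose p := ([tuple sval (q_ i) | i < n], k).
  have boxpx : box p x.
    split=> // i j; rewrite !ord1 mxE tnth_mktuple.
    by apply: ball_sym; exact: (svalP (q_ j)).
  exists p => // y py; apply: xeU; rewrite (splitr e%:num).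
  apply: (@ball_triangle _ _ (\row_i ratr (tnth p.1 i) : 'rV[R]_n)).
    by apply: ball_sym; apply: le_ball boxpx; exact: ltW.
  by apply: le_ball py; exact: ltW.
rewrite preimage_bigcup bigcup_mkcond.
apply: countable_bigcupT_measurable => // p.
case: ifPn => // _; rewrite (_ : _ @^-1` _ = \bigcap_(i in [set: 'I_n])
    ((@tnth n (measurableTypeR R) ^~ i) @^-1`
      ball (ratr (tnth p.1 i) : R) (p.2.+1%:R^-1 : R))).
  apply: fin_bigcap_measurable => // i _.
  rewrite -[X in measurable X]setTI; apply: measurable_tnth => //.
  by apply: open_measurable; exact: ball_open.
apply/seteqP; split=> [t [_ +] i _|t bt].
  by move=> /(_ ord0 i); rewrite !mxE.
by split=> // i j; rewrite !mxE; exact: bt.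
Qed.

Definition lebesgue_rV : set 'rV[R]_n -> \bar R :=
  pushforward (lebesgue_tuple R n) row_of_tuple.

Let lebesgue_rV0 : lebesgue_rV set0 = 0%E.
Proof. by rewrite /lebesgue_rV /pushforward preimage_set0 measure0. Qed.

Let lebesgue_rV_ge0 A : (0 <= lebesgue_rV A)%E.
Proof. by rewrite /lebesgue_rV /pushforward measure_ge0. Qed.

Let lebesgue_rV_sigma_additive : semi_sigma_additive lebesgue_rV.
Proof.
move=> F mF tF mUF; rewrite /lebesgue_rV /pushforward preimage_bigcup.
apply: measure_semi_sigma_additive.
- by move=> i; rewrite -[X in measurable X]setTI; exact: measurable_row_of_tuple.
- apply/trivIsetP => /= i j _ _ ij; rewrite -preimage_setI.
  by move/trivIsetP : tF => /(_ _ _ _ _ ij) ->//; rewrite preimage_set0.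
- by rewrite -preimage_bigcup -[X in measurable X]setTI;
    exact: measurable_row_of_tuple.
Qed.

HB.instance Definition _ := isMeasure.Build _ _ _ lebesgue_rV
  lebesgue_rV0 lebesgue_rV_ge0 lebesgue_rV_sigma_additive.

End lebesgue_rV.

Lemma lebesgue_rV_box (R : realType) (n : nat)
    (B : 'I_n -> set (measurableTypeR R)) : (forall i, measurable (B i)) ->
  lebesgue_rV [set x : 'rV[R]_n | forall i, B i (x 0 i)] =
  (\prod_(i < n) lebesgue_measure (B i))%E.
Proof.
move=> mB; rewrite -lebesgue_tuple_box// /lebesgue_rV /pushforward.
by congr (lebesgue_tuple R n _); apply/seteqP; split=> t /= h i;
  move: (h i); rewrite mxE.
Qed.

Section density.
Context {R : realType} {n : nat}.
Implicit Types (Omega C D A : set 'rV[R]_n) (f : 'rV[R]_n -> R).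
Implicit Types (mu : set 'rV[R]_n -> R).

Definition eucl_norm (x : 'rV[R]_n) : R := Num.sqrt (\sum_i x 0 i ^+ 2).

(* The norm of the library on 'rV is the sup norm; neighbourhoods are Euclidean.
   The two norms induce the same topology (open, closed, closure). *)
Definition open_nbhd C (delta : R) : set 'rV[R]_n :=
  [set x | exists2 y, C y & eucl_norm (x - y) < delta].

(* Redefining f as -oo (resp. +oo) off D makes the points outside D
   irrelevant to the essential supremum (resp. infimum) over the whole space. *)
Definition ess_sup_on D f : \bar R :=
  ess_sup lebesgue_rV (fun x => if x \in D then (f x)%:E else -oo%E).

Definition ess_inf_on D f : \bar R :=
  ess_inf lebesgue_rV (fun x => if x \in D then (f x)%:E else +oo%E).

(* Elements of L^oo(Omega) are given by representatives; their values outside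
   Omega are never used. *)
Definition Linfty Omega f : Prop :=
  measurable_fun Omega f /\ (ess_sup_on Omega (fun x => `|f x|%R) < +oo)%E.

(* Only the values of mu on the Borel subsets of Omega are constrained (and
   used): mu stands for a set function on B(Omega). *)
Record ba Omega mu : Prop := Ba {
  ba0 : mu set0 = 0 ;
  baU : forall A B, measurable A -> measurable B ->
    A `<=` Omega -> B `<=` Omega -> A `&` B = set0 ->
    mu (A `|` B) = mu A + mu B ;
  ba_bounded : exists M : R,
    forall A, measurable A -> A `<=` Omega -> `|mu A| <= M ;
  ba_null : forall A, measurable A -> A `<=` Omega ->
    lebesgue_rV A = 0%E -> mu A = 0 }.

Definition total_variation mu A : R :=
  sup [set s | exists m (F : 'I_m -> set 'rV[R]_n),
    [/\ forall i, measurable (F i) /\ F i `<=` A,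
        trivIset setT F & s = \sum_(i < m) `|mu (F i)|]].

Definition simple_integral Omega mu (h : 'rV[R]_n -> R) : \bar R :=
  sintegral (fun A => (mu (A `&` Omega))%:E) h.

(* The integral with respect to a finitely additive measure, in the sense of
   Dunford and Schwartz: h is a sequence of simple functions converging to f in
   measure and Cauchy in the mean with respect to the total variation of mu. *)
Definition determining_sequence Omega mu f
    (h : {sfun 'rV[R]_n >-> R}^nat) : Prop :=
  (forall e, 0 < e ->
     total_variation mu [set x | Omega x /\ e < `|f x - h k x|]
       @[k --> \oo] --> (0 : R)) /\
  (forall e, 0 < e -> exists N, forall k l, (N <= k)%N -> (N <= l)%N ->
     (simple_integral Omega (total_variation mu) (fun x => `|h k x - h l x|%R)
       < e%:E)%E).

Definition has_integral Omega mu f (I : R) : Prop :=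
  exists2 h, determining_sequence Omega mu f h &
    simple_integral Omega mu (h k) @[k --> \oo] --> I%:E.

Definition integral_ba Omega mu f : R := get (has_integral Omega mu f).

Record density_set Omega C : Prop := DensitySet {
  density_set_sub : C `<=` closure Omega ;
  density_set_neq0 : C !=set0 ;
  density_set_closed : closed C ;
  density_set_null : lebesgue_rV (C `&` Omega) = 0%E ;
  density_set_nbhd : forall delta, 0 < delta ->
    (0 < lebesgue_rV (open_nbhd C delta `&` Omega))%E }.

Record density_measure Omega C mu : Prop := DensityMeasure {
  density_measure_ba : ba Omega mu ;
  density_measure_ge0 : forall A, measurable A -> A `<=` Omega -> 0 <= mu A ;
  density_measure_nbhd : forall delta, 0 < delta ->
    mu (open_nbhd C delta `&` Omega) = mu Omega /\ mu Omega = 1 }.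

End density.

(* Main.v *)
Require Import Defs.
From mathcomp Require Import all_boot all_order all_algebra.
From mathcomp Require Import all_classical all_reals all_analysis.
From mathcomp Require Import measurable_realfun ess_sup_inf ring lra.
Set Implicit Arguments.
Unset Strict Implicit.
Unset Printing Implicit Defensive.
Import Order.TTheory GRing.Theory Num.Theory.
Import numFieldNormedType.Exports.
Import HBSimple.

Local Open Scope classical_set_scope.
Local Open Scope ring_scope.

(** Let [s] bound the essential supremum of [f] on the part of Omega within
    distance [e] of [C].  The set where [f > s] meets that part in a Lebesgue
    null set, which [mu] does not charge, and the rest of it lies outside the
    [e]-neighbourhood of [C], where a density measure has no mass.  So
    [f <= s] except on a [mu]-null set, and since [mu] has total mass 1 the
    integral is at most [s].  This holds for every [e]; the essential suprema
    decrease with [e], hence converge, and the bound passes to the limit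
    ([density_integral_le]).  The lower bound is the upper bound for [- f].

    The work is in the integral, which is that of Dunford and Schwartz for a
    finitely additive [mu], so pointwise convergence of functions says
    nothing about their integrals.  Two facts about it suffice.

    The integral exists for bounded [f] ([has_integral_ex]): rounding [f] down
    to a grid of mesh [1 / k.+1] gives simple functions converging uniformly off
    a null set, and uniform convergence controls both the convergence in
    measure and the mean Cauchy condition.

    Every value [I] of the integral satisfies [I <= s * mu Omega] once
    [f <= s] off a null set ([has_integral_le]).  As any determining sequence
    can occur here, even one with large values on small sets, this rests on the
    mean Cauchy condition ([charge_int_limit_le]): the excess of [h k] over [s]
    is dominated by [`|h k - h N|], which is small in mean, plus a constant
    independent of [k], supported on a set whose measure tends to 0.

    The elementary theory of integrals of simple functions is reduced to finite
    sums: finitely many simple functions are all functions of one labelling [G]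
    of the points by finitely many labels, and the integral of [u \o G] is the
    sum of [u c * m (G @^-1` [set c])] over the labels [c]
    ([sintegral_fibres]). *)

(** * Simple functions *)

Section simple_functions.
Context {d : measure_display} {T : measurableType d}.

(** The values are in an arbitrary type, so that a pair of simple functions is
    again a simple function. *)
Definition simple {K : choiceType} (g : T -> K) : Prop :=
  finite_set (range g) /\ forall c, measurable (g @^-1` [set c]).

Lemma simple_preimage (K : choiceType) (G : T -> K) (P : set K) :
  simple G -> measurable (G @^-1` P).
Proof.
move=> [finG mG].
have -> : G @^-1` P = \bigcup_(c in range G `&` P) (G @^-1` [set c]).
  apply/seteqP; split=> [x Px|x [c [_ Pc] /= Gxc]]; last by rewrite /= Gxc.
  by exists (G x) => //; split=> //; exists x.
by apply: fin_bigcup_measurable => [|c _]; [exact: finite_setIl|exact: mG].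
Qed.

Lemma simple_comp (K L : choiceType) (G : T -> K) (u : K -> L) :
  simple G -> simple (fun x => u (G x)).
Proof.
move=> sG; split; last first.
  by move=> c; exact: (@simple_preimage _ G (u @^-1` [set c])).
apply: (sub_finite_set _ (finite_image u sG.1)) => _ [x _ <-].
by exists (G x) => //; exists x.
Qed.

Lemma simple_pair (K L : choiceType) (G : T -> K) (H : T -> L) :
  simple G -> simple H -> simple (fun x => (G x, H x)).
Proof.
move=> [finG mG] [finH mH]; split.
  apply: (sub_finite_set _ (finite_setX finG finH)) => _ [x _ <-].
  by split; exists x.
move=> [a b].
have -> : (fun x => (G x, H x)) @^-1` [set (a, b)]
    = G @^-1` [set a] `&` H @^-1` [set b].
  by apply/seteqP; split=> x /= [-> ->].
exact: measurableI.
Qed.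

Lemma simple_cst (K : choiceType) (c : K) : simple (fun _ : T => c).
Proof.
split; first exact: finite_image_cst.
by move=> b; rewrite -[fun=> c]/(cst c) preimage_cst; case: ifP.
Qed.

Lemma simple_mem (A : set T) : measurable A -> simple (fun x => x \in A).
Proof.
move=> mA; split; first exact: finite_finset.
case.
- rewrite (_ : _ @^-1` _ = A)//; apply/seteqP; split=> x /=.
  + exact: set_mem.
  + exact: mem_set.
- rewrite (_ : _ @^-1` _ = ~` A); first exact: measurableC.
  apply/seteqP; split=> x /=.
  + by move=> /negbT; rewrite notin_setE.
  + exact: memNset.
Qed.

Lemma sfun_simple {R : realType} (h : {sfun T >-> R}) : simple (h : T -> R).
Proof.
split; first exact: fimfunP.
by move=> c; exact: measurable_funPTI.
Qed.

Lemma simple_bounded {R : realType} (g : T -> R) :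
  simple g -> exists2 B, 0 < B & forall x, `|g x| <= B.
Proof.
move=> [/finite_seqP[s gs] _].
exists (1 + \sum_(y <- s) `|y|) => [|x].
  by rewrite ltr_pwDl// sumr_ge0.
have : g x \in s by have : range g (g x) by []; rewrite gs.
move=> gxs; rewrite (big_rem (g x))//= addrCA lerDl addr_ge0// sumr_ge0//.
Qed.

Lemma simpleD {R : realType} (f g : T -> R) :
  simple f -> simple g -> simple (fun x => f x + g x).
Proof. by move=> sf /(simple_pair sf)/(@simple_comp _ _ _ (fun p => p.1 + p.2)). Qed.

Lemma simpleN {R : realType} (f : T -> R) : simple f -> simple (fun x => - f x).
Proof. exact: simple_comp. Qed.

Lemma simple_normB {R : realType} (f g : T -> R) :
  simple f -> simple g -> simple (fun x => `|f x - g x|).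
Proof.
by move=> sf /(simple_pair sf)/(@simple_comp _ _ _ (fun p => `|p.1 - p.2|)).
Qed.

End simple_functions.

(** * Integration of simple functions against a finitely additive measure *)

Section charge.
Context {d : measure_display} {T : measurableType d} {R : realType}.
Implicit Types (m : set T -> R) (f g : T -> R) (A : set T).

(** A finite and finitely additive measure. It is a function on all sets, but
    its values off the measurable ones are arbitrary. *)
Record nonneg_charge m : Prop := NonnegCharge {
  nncharge0 : m set0 = 0 ;
  nnchargeU : forall A B, measurable A -> measurable B -> A `&` B = set0 ->
    m (A `|` B) = m A + m B ;
  nncharge_ge0 : forall A, measurable A -> 0 <= m A }.

Variable m : set T -> R.
Hypothesis cm : nonneg_charge m.

Lemma le_nncharge A B : measurable A -> measurable B -> A `<=` B -> m A <= m B.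
Proof.
move=> mA mB AB; have mBA := measurableD mB mA.
rewrite -(setDUK AB) (nnchargeU cm)// ?lerDl ?(nncharge_ge0 cm)//.
by rewrite setDE setICA setICr setI0.
Qed.

Lemma le_nnchargeU A B : measurable A -> measurable B ->
  m (A `|` B) <= m A + m B.
Proof.
move=> mA mB; have mBA := measurableD mB mA.
have -> : A `|` B = A `|` (B `\` A).
  apply/seteqP; split=> x; last by case; [left|case=> ? _; right].
  by have [Ax|nAx] := pselect (A x); [left|case=> // Bx; right].
rewrite (nnchargeU cm)//; last by rewrite setDE setICA setICr setI0.
by rewrite lerD2l le_nncharge// => x [].
Qed.

Lemma charge_bigsetU (I : choiceType) (s : seq I) (F : I -> set T) :
  uniq s -> (forall i, measurable (F i)) -> trivIset [set` s] F ->
  m (\big[setU/set0]_(i <- s) F i) = \sum_(i <- s) m (F i).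
Proof.
move=> + mF; elim: s => [_ _|i s IH /= /andP[iNs us] tF].
  by rewrite !big_nil (nncharge0 cm).
rewrite !big_cons (nnchargeU cm)//; last 2 first.
- exact: bigsetU_measurable.
- rewrite -subset0 => x [Fix].
  rewrite -bigcup_seq => -[j /= js Fjx].
  have := tF i j; rewrite /= !inE eqxx js orbT => /(_ isT isT) ij.
  by move: iNs; rewrite ij ?js//; exists x.
rewrite IH//; apply: sub_trivIset tF => j /= js.
by rewrite inE js orbT.
Qed.

Lemma charge_fibres (K : choiceType) (G : T -> K) (s : seq K) A :
  uniq s -> (forall x, G x \in s) -> simple G -> measurable A ->
  m A = \sum_(c <- s) m (A `&` G @^-1` [set c]).
Proof.
move=> us Gs [_ mG] mA; rewrite -charge_bigsetU//.
- congr m; rewrite -bigcup_seq; apply/seteqP; split=> [x Ax|x [c _ [Ax _]]//].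
  by exists (G x) => //=; exact: Gs.
- by move=> c; exact: measurableI.
- by move=> a b _ _ [x [[_ /= Ga] [_ /= Gb]]]; rewrite -Ga.
Qed.

(** Grouping the points by label instead of by value leaves the integral
    unchanged, by additivity of [m] over the fibres of [G].  With [G] a tuple of
    functions and [u] an expression in its components, linearity and
    monotonicity become termwise facts about finite sums. *)
Lemma sintegral_fibres (K : choiceType) (G : T -> K) (s : seq K) (u : K -> R) :
  uniq s -> (forall x, G x \in s) -> simple G ->
  sintegral (fun A => (m A)%:E) (fun x => u (G x)) =
  (\sum_(c <- s) u c * m (G @^-1` [set c]))%:E.
Proof.
move=> us Gs sG; pose g x := u (G x).
pose r := undup (map u s).
have gr x : g x \in r by rewrite mem_undup; apply: map_f.
rewrite /sintegral -(fsbig_widen [set` r])//; last first.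
  move=> y /= [_ yr]; rewrite (_ : _ @^-1` _ = set0) ?(nncharge0 cm) ?mule0//.
  by rewrite -subset0 => x /= gxy; apply: yr; rewrite -gxy; exact: gr.
rewrite -fsbig_seq ?undup_uniq//.
under eq_bigr do rewrite -EFinM.
rewrite sumEFin; congr EFin.
under eq_bigr => y _.
  rewrite (@charge_fibres _ G s)//; last exact: (simple_comp u sG).2.
  rewrite mulr_sumr; over.
rewrite exchange_big/=; apply: eq_big_seq => c cs.
rewrite (bigD1_seq (u c)) ?undup_uniq//=; last by rewrite mem_undup; apply: map_f.
rewrite big1 ?addr0 => [|y yuc].
  congr (_ * m _); apply/seteqP; split=> [x []//|x /= Gxc].
  by split=> //=; rewrite Gxc.
rewrite (_ : _ `&` _ = set0) ?(nncharge0 cm) ?mulr0//.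
by rewrite -subset0 => x [/= uGx Gxc]; rewrite -uGx Gxc eqxx in yuc.
Qed.

(** The integral is finite on simple functions, which makes real arithmetic
    available. *)
Definition charge_int g : R := fine (sintegral (fun A => (m A)%:E) g).

Lemma simple_seq (K : choiceType) (G : T -> K) :
  simple G -> exists2 s, uniq s & forall x, G x \in s.
Proof.
move=> [/finite_seqP[s Gs] _]; exists (undup s); first exact: undup_uniq.
by move=> x; rewrite mem_undup; have : range G (G x) by []; rewrite Gs.
Qed.

Lemma charge_int_fibres (K : choiceType) (G : T -> K) (s : seq K) (u : K -> R) :
  uniq s -> (forall x, G x \in s) -> simple G ->
  charge_int (fun x => u (G x)) = \sum_(c <- s) u c * m (G @^-1` [set c]).
Proof. by move=> us Gs sG; rewrite /charge_int (sintegral_fibres _ us). Qed.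

Lemma sintegral_charge g : simple g ->
  sintegral (fun A => (m A)%:E) g = (charge_int g)%:E.
Proof.
move=> sg; have [s us gs] := simple_seq sg.
by rewrite /charge_int (@sintegral_fibres _ g s id).
Qed.

Lemma charge_intD f g : simple f -> simple g ->
  charge_int (fun x => f x + g x) = charge_int f + charge_int g.
Proof.
move=> sf sg; have sfg := simple_pair sf sg.
have [s us fgs] := simple_seq sfg.
rewrite (@charge_int_fibres _ _ s (fun p => p.1 + p.2) us fgs sfg).
rewrite (@charge_int_fibres _ _ s fst us fgs sfg).
rewrite (@charge_int_fibres _ _ s snd us fgs sfg).
by rewrite -big_split/=; apply: eq_bigr => c _; rewrite mulrDl.
Qed.

Lemma charge_intN f : simple f ->
  charge_int (fun x => - f x) = - charge_int f.
Proof.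
move=> sf; have [s us fs] := simple_seq sf.
rewrite (@charge_int_fibres _ _ s -%R us fs sf).
rewrite (@charge_int_fibres _ _ s id us fs sf).
by rewrite -sumrN; apply: eq_bigr => c _; rewrite mulNr.
Qed.

Lemma le_charge_int f g : simple f -> simple g -> (forall x, f x <= g x) ->
  charge_int f <= charge_int g.
Proof.
move=> sf sg fg; have sfg := simple_pair sf sg.
have [s us fgs] := simple_seq sfg.
rewrite (@charge_int_fibres _ _ s fst us fgs sfg).
rewrite (@charge_int_fibres _ _ s snd us fgs sfg).
apply: ler_sum => c _.
have [->|/set0P[x /= <-]] := eqVneq ((fun x => (f x, g x)) @^-1` [set c]) set0.
  by rewrite (nncharge0 cm) !mulr0.
have := fg x; apply: ler_wpM2r; apply: (nncharge_ge0 cm); exact: sfg.2.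
Qed.

Lemma charge_int_cst (c : R) : charge_int (fun _ : T => c) = c * m setT.
Proof.
rewrite (@charge_int_fibres _ (fun=> tt) [:: tt] (fun=> c))//; last first.
  exact: simple_cst.
by rewrite big_seq1 -[fun=> tt]/(cst tt) preimage_cst mem_set.
Qed.

Lemma charge_int_mem (c : R) A : measurable A ->
  charge_int (fun x => c * (x \in A)%:R) = c * m A.
Proof.
move=> mA.
rewrite (@charge_int_fibres _ _ [:: true; false] (fun b : bool => c * b%:R))//.
- rewrite !big_cons big_nil mulr1 mulr0 mul0r !addr0; congr (_ * m _).
  by apply/seteqP; split=> x /=; [exact: set_mem|exact: mem_set].
- by move=> x; case: (x \in A).
- exact: simple_mem.
Qed.

Lemma charge_int_dist f g : simple f -> simple g ->
  `|charge_int f - charge_int g| <= charge_int (fun x => `|f x - g x|).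
Proof.
move=> sf sg; have sfg := simple_normB sf sg.
rewrite ler_distl lerBlDr -!charge_intD//.
by apply/andP; split; apply: le_charge_int => //;
  try (exact: simpleD); move=> x; move: (ler_norm (f x - g x));
  move: (ler_norm (g x - f x)); rewrite (distrC (g x)); lra.
Qed.

(** The convergence of [m [set x | t < h k x]] to 0 alone does not bound the
    limit of the integrals, because [h k] may be large where it exceeds [t].
    The Cauchy condition gives an [N] with [h k] close to [h N] in mean, and
    [h N] is bounded, so that the part of the integral of [h k] over this
    vanishing set is small. *)
Lemma charge_int_limit_le (h : nat -> T -> R) (t I : R) :
  (forall k, simple (h k)) ->
  (forall e, 0 < e -> exists N, forall k l, (N <= k)%N -> (N <= l)%N ->
    charge_int (fun x => `|h k x - h l x|) < e) ->
  (m [set x | t < h k x] @[k --> \oo] --> (0 : R)) ->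
  charge_int (h k) @[k --> \oo] --> I ->
  I <= t * m setT.
Proof.
move=> sh cauchy m0 hI; apply/ler_addgt0Pr => e e0.
have e20 : 0 < e / 2 by rewrite divr_gt0.
have [N hN] := cauchy _ e20.
have [B B0 hB] := simple_bounded (sh N).
have Bt0 : 0 < B + `|t| by rewrite ltr_pwDl.
rewrite -(cvg_lim _ hI)//; apply: limr_le; first by apply/cvg_ex; exists I.
have d0 : 0 < (e / 2) / (B + `|t|) by rewrite divr_gt0.
have /cvgr0Pnorm_lt/(_ _ d0)[M _ hM] := m0.
exists (maxn N M) => // k /=; rewrite geq_max => /andP[Nk Mk].
pose A := [set x | t < h k x].
have mA : measurable A by exact: (@simple_preimage _ _ _ (h k) [set y | t < y]).
have smA : simple (fun x => (B + `|t|) * (x \in A)%:R).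
  apply: (@simple_comp _ _ _ _ _ (fun b : bool => (B + `|t|) * b%:R)).
  exact: simple_mem.
have sd := simple_normB (sh k) (sh N).
have sc : simple (fun _ : T => t) by exact: simple_cst.
(* Where [h k x <= t] the first term suffices; elsewhere
   [h k x <= `|h k x - h N x| + B] and [B <= t + (B + `|t|)]. *)
have : charge_int (h k) <= charge_int (fun x => t + (`|h k x - h N x| +
    (B + `|t|) * (x \in A)%:R)).
  apply: le_charge_int => //; first by apply: simpleD => //; exact: simpleD.
  move=> x; have [Ax|nAx] := pselect (A x).
    rewrite mem_set// mulr1.
    move: (ler_norm (h k x - h N x)) (ler_norm (h N x)) (hB x) (ler_norm (- t)).
    by rewrite normrN; lra.
  rewrite memNset// mulr0 addr0; move/negP : nAx; rewrite -leNgt.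
  by move: (normr_ge0 (h k x - h N x)); lra.
rewrite charge_intD// ?charge_intD//; last exact: simpleD.
rewrite charge_int_cst charge_int_mem//.
have : charge_int (fun x => `|h k x - h N x|) < e / 2.
  exact: hN.
have : (B + `|t|) * m A < e / 2.
  rewrite mulrC -ltr_pdivlMr//; apply: (le_lt_trans (ler_norm _)).
  exact: hM.
lra.
Qed.

End charge.

(** * Uniform approximation by simple functions *)

Section approximation.
Context {d : measure_display} {T : measurableType d} {R : realType}.

Lemma simple_sfun (g : T -> R) :
  simple g -> exists h : {sfun T >-> R}, forall x, h x = g x.
Proof.
move=> sg.
have gP : g \in (sfun : {pred T -> R}).
  apply/andP; split; rewrite inE; last exact: sg.1.
  by move=> _ Y mY; rewrite setTI; exact: simple_preimage.
by exists (sfun_Sub gP).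
Qed.

Lemma simple_nat (G : T -> nat) (N : nat) : (forall x, (G x <= N)%N) ->
  (forall n, measurable [set x | (n < G x)%N]) -> simple G.
Proof.
move=> GN mG; split.
  apply: (sub_finite_set _ (finite_II N.+1)) => _ [x _ <-] /=.
  by rewrite ltnS.
case=> [|c].
  rewrite (_ : _ @^-1` _ = ~` [set x | (0 < G x)%N]); first exact: measurableC.
  by apply/seteqP; split=> x /=; case: (G x).
rewrite (_ : _ @^-1` _ = [set x | (c < G x)%N] `\` [set x | (c.+1 < G x)%N]).
  exact: measurableD.
apply/seteqP; split=> x /=; first by move=> ->; rewrite ltnn leqnn; split.
by move=> [cG /negP]; rewrite -leqNgt => Gc; apply/eqP; rewrite eqn_leq Gc cG.
Qed.

(** Round [f + B], which is nonnegative, down to a multiple of [1 / k.+1]. *)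
Lemma simple_approx (f : T -> R) (B : R) (k : nat) :
  measurable_fun setT f -> (forall x, `|f x| <= B) ->
  exists h : {sfun T >-> R}, forall x, `|h x - f x| <= k.+1%:R^-1.
Proof.
move=> mf fB; pose z x := (f x + B) * k.+1%:R.
have z0 x : 0 <= z x.
  by rewrite mulr_ge0//; move: (fB x) (ler_norm (- f x)); rewrite normrN; lra.
have sG : simple (fun x => Num.truncn (z x)).
  apply: (@simple_nat _ (Num.truncn (2 * B * k.+1%:R))) => [x|n].
    apply: le_truncn; rewrite ler_pM2r//.
    by move: (fB x) (ler_norm (f x)); lra.
  rewrite (_ : mkset _ = setT `&` z @^-1` `[n.+1%:R, +oo[); last first.
    rewrite setTI; apply/seteqP; split=> x /=;
      by rewrite in_itv/= andbT truncn_gt_nat.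
  have mz : measurable_fun setT z.
    by apply: measurable_funM => //; apply: measurable_funD.
  exact: mz.
have [h hE] := simple_sfun (simple_comp (fun n => n%:R / k.+1%:R - B) sG).
exists h => x; rewrite hE.
have k0 : 0 < k.+1%:R :> R by [].
have /andP[] := truncn_itv (z0 x).
move: (Num.truncn (z x)) => t; rewrite -natr1 => t1 t2.
have -> : t%:R / k.+1%:R - B - f x = (t%:R - z x) / k.+1%:R.
  by rewrite /z; field; rewrite gt_eqF.
rewrite normrM [`|_^-1|]ger0_norm ?invr_ge0// distrC ger0_norm; last lra.
by rewrite ler_piMl ?invr_ge0//; lra.
Qed.

End approximation.

(** * The Dunford-Schwartz integral on Omega *)

Section charge_on_Omega.
Context {R : realType} {n : nat} (Omega : set 'rV[R]_n).
Context (mu : set 'rV[R]_n -> R).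
Hypothesis mOmega : measurable Omega.
Hypothesis bamu : ba Omega mu.
Hypothesis mu_ge0 : forall A, measurable A -> A `<=` Omega -> 0 <= mu A.
Implicit Types (f : 'rV[R]_n -> R) (A : set 'rV[R]_n).

Local Notation m := (fun A => mu (A `&` Omega)).

(** Intersecting with Omega turns [mu], which is constrained only on subsets of
    Omega, into a finitely additive measure on the whole space. *)
Lemma ba_nonneg_charge : nonneg_charge m.
Proof.
split=> [|A B mA mB AB0|A mA].
- by rewrite set0I (ba0 bamu).
- rewrite setIUl (baU bamu)//; [exact: measurableI|exact: measurableI|].
  by rewrite setIACA AB0 set0I.
- by apply: mu_ge0 => //; exact: measurableI.
Qed.

Let cm := ba_nonneg_charge.

(** For a nonnegative [mu] the supremum is attained by the trivial family
    consisting of [A] alone. *)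
Lemma total_variation_nonneg A : measurable A -> A `<=` Omega ->
  Defs.total_variation mu A = mu A.
Proof.
move=> mA AO; rewrite /Defs.total_variation; set S := [set _ | _].
have S_le s : S s -> s <= mu A.
  move=> [k [F [mF tF ->]]].
  have FO i : F i `&` Omega = F i.
    by rewrite setIidl//; apply: subset_trans AO; exact: (mF i).2.
  have -> : \sum_(i < k) `|mu (F i)| = \sum_(i < k) m (F i).
    apply: eq_bigr => i _; rewrite FO ger0_norm// mu_ge0//; first exact: (mF i).1.
    by rewrite -FO.
  rewrite -(charge_bigsetU cm) ?index_enum_uniq//; last 2 first.
  - by move=> i; exact: (mF i).1.
  - exact: sub_trivIset tF.
  rewrite -[in leRHS](setIidl AO); apply: (le_nncharge cm) => //.
    by apply: bigsetU_measurable => i _; exact: (mF i).1.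
  by rewrite -bigcup_seq => x [i _]; exact: (mF i).2.
have SA : S (mu A).
  exists 1, (fun=> A); split=> [//|i j _ _ _|]; [by split|by rewrite !ord1|].
  by rewrite big_ord1 ger0_norm// mu_ge0.
apply/eqP; rewrite eq_le; apply/andP; split.
  by apply: ge_sup => //; exists (mu A).
by apply: ub_le_sup => //; exists (mu A) => s; exact: S_le.
Qed.

Lemma simple_integral_charge (g : 'rV[R]_n -> R) : simple g ->
  simple_integral Omega mu g = (charge_int m g)%:E.
Proof. by move=> sg; rewrite /simple_integral (sintegral_charge cm). Qed.

Lemma simple_integral_total_variation (g : 'rV[R]_n -> R) : simple g ->
  simple_integral Omega (Defs.total_variation mu) g = (charge_int m g)%:E.
Proof.
move=> sg; rewrite -simple_integral_charge// /simple_integral /sintegral.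
apply: eq_fsbigr => y _; rewrite total_variation_nonneg//.
by apply: measurableI => //; exact: sg.2.
Qed.

Lemma measurable_deviation f (h : {sfun 'rV[R]_n >-> R}) (e : R) :
  measurable_fun Omega f -> measurable [set x | Omega x /\ e < `|f x - h x|].
Proof.
move=> mf.
have mfh : measurable_fun Omega (fun x => `|f x - h x|).
  apply: measurableT_comp => //; apply: measurable_funB => //.
  exact: measurable_funTS.
rewrite (_ : mkset _ = Omega `&` (fun x => `|f x - h x|) @^-1` `]e, +oo[).
  exact: mfh.
by apply/seteqP; split=> x /=; rewrite in_itv/= andbT.
Qed.

Lemma measurable_superlevel f (s : R) :
  measurable_fun Omega f -> measurable [set x | Omega x /\ s < f x].
Proof.
move=> mf; rewrite (_ : mkset _ = Omega `&` f @^-1` `]s, +oo[); first exact: mf.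
by apply/seteqP; split=> x /=; rewrite in_itv/= andbT.
Qed.

Lemma ess_sup_on_null (D : set 'rV[R]_n) f (s : R) :
  measurable [set x | D x /\ s < f x] -> (ess_sup_on D f <= s%:E)%E ->
  lebesgue_rV [set x | D x /\ s < f x] = 0%E.
Proof.
move=> mA /ess_supP[N [mN N0 sN]]; apply: (subset_measure0 mA mN _ N0).
move=> x [Dx sx]; apply: sN => /=; rewrite mem_set// lee_fin.
by apply/negP; rewrite -ltNge.
Qed.

Lemma measurable_fun_normr f :
  measurable_fun Omega f -> measurable_fun Omega (fun x => `|f x|).
Proof. exact: measurableT_comp. Qed.

Lemma Linfty_bounded f : Linfty Omega f ->
  exists2 B, 0 <= B & mu [set x | Omega x /\ B < `|f x|] = 0.
Proof.
move=> [/measurable_fun_normr mnf supf].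
pose S := ess_sup_on Omega (fun x => `|f x|).
(* If [S] is -oo, [fine S] is 0, which is still a bound. *)
exists (Num.max 0 (fine S)); first by rewrite le_max lexx.
apply: (ba_null bamu).
- exact: measurable_superlevel.
- by move=> x [].
- apply: (ess_sup_on_null (measurable_superlevel _ mnf)).
  rewrite -/S EFin_max; move: supf; rewrite -/S; case: S => [r| |]//= _.
    by rewrite le_max lexx orbT.
  by rewrite leNye.
Qed.

(** The integral of [f] is obtained from the function [F] equal to [f] where
    [`|f| <= B] and to 0 elsewhere: [F] is bounded everywhere, hence is a
    uniform limit of simple functions, and it differs from [f] only on a
    [mu]-null subset of Omega. *)
Lemma has_integral_ex f : Linfty Omega f -> exists I, has_integral Omega mu f I.
Proof.
move=> Lf; have [mf _] := Lf; have [B B0 fB] := Linfty_bounded Lf.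
have mnf := measurable_fun_normr mf.
pose D := [set x | Omega x /\ `|f x| <= B].
have mD : measurable D.
  rewrite (_ : D = Omega `&` (fun x => `|f x|) @^-1` `]-oo, B]); first exact: mnf.
  by apply/seteqP; split=> x; rewrite /D/= in_itv/=.
pose F := f \_ D.
have FE x : D x -> F x = f x by move=> Dx; rewrite /F patchE mem_set.
have mF : measurable_fun setT F.
  by apply/(measurable_restrictT _ mD); apply: measurable_funS mf => // x [].
have FB x : `|F x| <= B.
  rewrite /F patchE; case: ifPn => [|_]; first by rewrite inE => -[].
  by rewrite normr0.
have [h hF] := choice (fun k => simple_approx k mF FB).
have sh k := sfun_simple (h k).
have hcauchy e : 0 < e -> exists N, forall k l, (N <= k)%N -> (N <= l)%N ->
    charge_int m (fun x => `|h k x - h l x|) < e.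
  move=> e0; have mT0 : 0 <= mu (setT `&` Omega) by apply: (nncharge_ge0 cm).
  have M0 : 0 < 2 * (mu (setT `&` Omega) + 1) by rewrite mulr_gt0// ltr_wpDl.
  have [N _ hN] := near_infty_natSinv_lt (PosNum (divr_gt0 e0 M0)).
  exists N => k l Nk Nl; have := hN _ Nk; have := hN _ Nl => /=.
  rewrite !ltr_pdivlMr// => le_ ke_.
  have k0 : 0 <= k.+1%:R^-1 :> R by rewrite invr_ge0.
  have l0 : 0 <= l.+1%:R^-1 :> R by rewrite invr_ge0.
  apply: (@le_lt_trans _ _ ((k.+1%:R^-1 + l.+1%:R^-1) * mu (setT `&` Omega))).
    rewrite -(charge_int_cst cm); apply: (le_charge_int cm).
    - exact: simple_normB.
    - exact: simple_cst.
    - move=> x; have := ler_normD (h k x - F x) (F x - h l x).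
      rewrite addrA subrK => /le_trans; apply.
      by rewrite lerD// distrC.
  move: k0 l0 le_ ke_; move: k.+1%:R^-1 l.+1%:R^-1 => a b; lra.
have : cauchy ((charge_int m (h k)) @[k --> \oo]).
  apply: cauchy_exP => e e0; have [N hN] := hcauchy _ e0.
  exists (charge_int m (h N)); exists N => // k /= Nk.
  apply: le_lt_trans (hN N k _ Nk) => //; exact: (charge_int_dist cm).
move=> /cauchy_cvgP/cvg_ex[I hI].
exists I; exists h; last first.
  under eq_fun do rewrite simple_integral_charge//.
  by apply: cvg_EFin; [exact: nearW|exact: hI].
split=> e e0; last first.
  have [N hN] := hcauchy _ e0; exists N => k l Nk Nl.
  rewrite simple_integral_total_variation ?lte_fin; first exact: hN.
  exact: simple_normB.
(* As soon as [k.+1%:R^-1 < e], a deviation larger than [e] can only occur where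
   [F] differs from [f]. *)
apply/cvgrPdist_lt => eps eps0.
have [N _ hN] := near_infty_natSinv_lt (PosNum e0).
exists N => // k /= Nk.
have mk := measurable_deviation (h k) e mf.
rewrite total_variation_nonneg//; last by move=> x [].
rewrite (_ : mu _ = 0) ?subrr ?normr0//; apply/eqP.
rewrite eq_le mu_ge0 ?andbT//; last by move=> x [].
have sO B' (g : 'rV[R]_n -> R) : [set x | Omega x /\ B' < g x] `<=` Omega.
  by move=> x [].
rewrite -fB -(setIidl (sO _ _)) -[in leRHS](setIidl (sO _ _)).
apply: (le_nncharge cm) => //; first exact: measurable_superlevel.
move=> x /= [Ox ex]; split=> //; rewrite ltNge; apply/negP => fxB.
move: ex; rewrite -FE// distrC ltNge => /negP; apply.
by apply: (le_trans (hF k x)); apply: ltW; exact: hN.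
Qed.

(** Where [h k] exceeds [s + e], either [f] exceeds [s], on a null set, or [h k]
    is at distance more than [e] from [f], on a set of vanishing measure. *)
Lemma has_integral_le f (I s : R) : measurable_fun Omega f ->
  mu [set x | Omega x /\ s < f x] = 0 -> has_integral Omega mu f I ->
  I <= s * mu Omega.
Proof.
move=> mf fs0 [h [hf hcauchy] hI].
have sh k := sfun_simple (h k).
(* The margin [e] is needed because convergence in measure says nothing about
   the sets where [h k] exceeds [s] only slightly. *)
suff H e : 0 < e -> I <= (s + e) * mu Omega.
  have mu0 : 0 <= mu Omega by exact: mu_ge0.
  apply/ler_addgt0Pr => e e0.
  have M0 : 0 < mu Omega + 1 by rewrite ltr_wpDl.
  apply: le_trans (H (e / (mu Omega + 1)) _) _; first by rewrite divr_gt0.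
  by rewrite mulrDl lerD2l mulrAC ler_pdivrMr// ler_pM2l// lerDl.
move=> e0; rewrite -(setTI Omega); apply: (charge_int_limit_le cm sh).
- move=> eps /hcauchy[N hN]; exists N => k l Nk Nl.
  have := hN _ _ Nk Nl; rewrite simple_integral_total_variation ?lte_fin//.
  exact: simple_normB.
- apply: (@squeeze_cvgr _ _ _ _ (fun=> 0)
    (fun k => Defs.total_variation mu [set x | Omega x /\ e < `|f x - h k x|])).
  + apply: nearW => k /=.
    have mU : measurable [set x | s + e < h k x].
      exact: (simple_preimage [set y | s + e < y] (sh k)).
    rewrite (nncharge_ge0 cm)//=.
    have mk := measurable_deviation (h k) e mf.
    have ms := measurable_superlevel s mf.
    have sO (P : set 'rV[R]_n) : [set x | Omega x /\ P x] `<=` Omega by move=> x [].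
    rewrite total_variation_nonneg//.
    rewrite -[leRHS]add0r -fs0 -[in leRHS](setIidl (sO (fun x => s < f x))).
    rewrite -[in leRHS](setIidl (sO (fun x => e < `|f x - h k x|))).
    apply: (le_trans _ (le_nnchargeU cm ms mk)).
    rewrite -[in leLHS](setIid Omega) setIA.
    apply: (le_nncharge cm); [exact: measurableI|exact: measurableU|].
    move=> x [/= hx Ox]; have [fx|fx] := ltP s (f x); [by left|right; split=> //].
    by move: (ler_norm (h k x - f x)); rewrite distrC; lra.
  + exact: cvg_cst.
  + exact: hf.
- move: hI; rewrite (_ : (fun k => _) = (fun k => (charge_int m (h k))%:E)).
    by move/fine_cvgP => [].
  by apply/funext => k; rewrite simple_integral_charge.
Qed.

Lemma has_integralN f (I : R) : has_integral Omega mu f I ->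
  has_integral Omega mu (fun x => - f x) (- I).
Proof.
move=> [h [hf hcauchy] hI].
have sh k := sfun_simple (h k).
have [g gE] := choice (fun k => simple_sfun (simpleN (sh k))).
have {}gE k : g k = (fun x => - h k x) :> ('rV[R]_n -> R) by apply/funext; exact: gE.
exists g; last first.
  rewrite EFinN (_ : (fun k => _) = (fun k => - simple_integral Omega mu (h k))%E).
    exact: cvgeN.
  apply/funext => k; rewrite gE !simple_integral_charge//; last exact: simpleN.
  by rewrite (charge_intN cm).
split=> e e0.
  rewrite (_ : (fun k => _) = (fun k =>
    Defs.total_variation mu [set x | Omega x /\ e < `|f x - h k x|])).
    exact: hf.
  apply/funext => k; rewrite gE; congr (Defs.total_variation mu _).
  by apply/funext => x; rewrite /= -opprD normrN.
have [N hN] := hcauchy _ e0; exists N => k l Nk Nl.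
rewrite !gE (_ : (fun x => _) = (fun x => `|h k x - h l x|)); first exact: hN.
by apply/funext => x; rewrite -opprD normrN.
Qed.

End charge_on_Omega.

(** * Essential suprema near a set *)

Section neighbourhoods.
Context {R : realType} {n : nat}.
Implicit Types (C D : set 'rV[R]_n) (f : 'rV[R]_n -> R).

Lemma eucl_dist_continuous (y : 'rV[R]_n) :
  continuous (fun x : 'rV[R]_n => eucl_norm (x - y)).
Proof.
move=> x; apply: (@continuous_comp _ _ _
    (fun x : 'rV[R]_n => \sum_i (x - y) 0 i ^+ 2) Num.sqrt); last first.
  exact: sqrt_continuous.
apply: continuous_big => [|i _ {}x]; first exact: add_continuous.
apply: (@continuous_comp _ _ _ (fun x : 'rV[R]_n => (x - y) 0 i) (fun r => r ^+ 2)).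
  rewrite (_ : (fun _ => _) = (fun x : 'rV[R]_n => x 0 i - y 0 i)).
    have cx := @coord_continuous R 1 n 0 i x.
    exact: (cvgB cx (cvg_cst (y 0 i))).
  by apply/funext => z; rewrite !mxE.
exact: exprn_continuous.
Qed.

Lemma open_nbhd_open C (e : R) : open (open_nbhd C e).
Proof.
rewrite (_ : open_nbhd C e =
    \bigcup_(y in C) (fun x => eucl_norm (x - y)) @^-1` [set r | r < e]); last first.
  by apply/seteqP; split=> x [y Cy xy]; exists y.
apply: bigcup_open => y _.
have /continuousP cont_dist := @eucl_dist_continuous y.
by apply: cont_dist; exact: open_lt.
Qed.

Lemma open_nbhdS C (e e' : R) : e <= e' -> open_nbhd C e `<=` open_nbhd C e'.
Proof. by move=> ee' x [y Cy xy]; exists y => //; exact: lt_le_trans xy ee'. Qed.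

Lemma ess_sup_onS D D' f : D `<=` D' -> (ess_sup_on D f <= ess_sup_on D' f)%E.
Proof.
move=> DD'; apply: le_ess_sup; apply: nearW => x.
case: ifPn => [|_]; last exact: leNye.
by rewrite inE => /DD' D'x; rewrite mem_set.
Qed.

Lemma ess_inf_onN D f : ess_inf_on D f = (- ess_sup_on D (fun x => - f x)%R)%E.
Proof.
rewrite /ess_inf_on ess_infEN; congr (- ess_sup _ _)%E.
by apply/funext => x; case: ifP.
Qed.

Lemma ess_sup_near_cvg C D f :
  cvg (ess_sup_on (open_nbhd C e `&` D) f @[e --> 0^'+]).
Proof.
apply/cvg_ex; eexists.
apply: (@nondecreasing_at_right_cvge R _ 0 +oo%O) => // e e' _ _ ee'.
by apply: ess_sup_onS; apply: setSI; exact: open_nbhdS.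
Qed.

End neighbourhoods.

(** For each [e] the set where [f] exceeds an essential upper bound on the
    [e]-neighbourhood of [C] is [mu]-null: inside this neighbourhood it is
    Lebesgue null, and outside [mu] vanishes. *)
Lemma density_integral_le (R : realType) (n : nat) (Omega C : set 'rV[R]_n)
    (mu : set 'rV[R]_n -> R) (f : 'rV[R]_n -> R) (I : R) :
  measurable Omega -> density_measure Omega C mu -> measurable_fun Omega f ->
  has_integral Omega mu f I ->
  (I%:E <= lim (ess_sup_on (open_nbhd C e `&` Omega) f @[e --> 0^'+]))%E.
Proof.
move=> mOmega [bamu mu_ge0 muC] mf fI.
apply: lime_ge; first exact: ess_sup_near_cvg.
near=> e; have e0 : 0 < e by near: e; exact: nbhs_right_gt.
have [muCe mu1] := muC e e0.
have cm := ba_nonneg_charge mOmega bamu mu_ge0.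
have mCe : measurable (open_nbhd C e).
  by apply: open_measurable_rV; exact: open_nbhd_open.
suff H s : (ess_sup_on (open_nbhd C e `&` Omega) f <= s%:E)%E -> I <= s.
  move: H; case: (ess_sup_on _ _) => [r| |] H.
  - by rewrite lee_fin H.
  - exact: leey.
  - by exfalso; have := H (I - 1) (leNye _); lra.
move=> fs; rewrite -[leRHS]mulr1 -mu1.
apply: (has_integral_le mOmega bamu mu_ge0 mf _ fI).
set A := [set x | _].
have mA : measurable A by exact: measurable_superlevel.
have AO : A `<=` Omega by move=> x [].
have mACe := measurableI _ _ mA mCe.
have mOCe := measurableD mOmega mCe.
have null_far : mu (Omega `\` open_nbhd C e) = 0.
  have := nnchargeU cm mCe mOCe; rewrite setDE setICA setICr setI0 => /(_ erefl).
  rewrite -setDE (_ : (_ `|` _) `&` _ = Omega) ?muCe.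
    by rewrite (setIidl (@subDsetl _ _ _)); lra.
  apply/seteqP; split=> [x []//|x Ox]; split=> //.
  by have [Cx|nCx] := pselect (open_nbhd C e x); [left|right].
have null_near : mu (A `&` open_nbhd C e) = 0.
  apply: (ba_null bamu) => //; first by move=> x [/AO].
  have E : A `&` open_nbhd C e = [set x | (open_nbhd C e `&` Omega) x /\ s < f x].
    by apply/seteqP; split=> x /=; rewrite /A/=; tauto.
  by rewrite E; apply: ess_sup_on_null => //; rewrite -E.
apply/eqP; rewrite eq_le mu_ge0// andbT.
have := le_nnchargeU cm mACe mOCe.
rewrite (setIidl (@subDsetl _ _ _)) (setIidl (subset_trans (@subIsetl _ _ _) AO)).
rewrite null_far null_near addr0; apply: le_trans.
rewrite -[in leLHS](setIidl AO); apply: (le_nncharge cm) => //.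
  exact: measurableU.
move=> x Ax; have [Cx|nCx] := pselect (open_nbhd C e x); first by left.
by right; split=> //; exact: AO.
Unshelve. all: by end_near. Qed.

Theorem proposition3p10 (R : realType) (n : nat) (Omega C : set 'rV[R]_n)
    (mu : set 'rV[R]_n -> R) :
  measurable Omega ->
  density_set Omega C ->
  density_measure Omega C mu ->
  forall f : 'rV[R]_n -> R, Linfty Omega f ->
  let inf_near delta := ess_inf_on (open_nbhd C delta `&` Omega) f in
  let sup_near delta := ess_sup_on (open_nbhd C delta `&` Omega) f in
  [/\ cvg (inf_near delta @[delta --> 0^'+]),
      cvg (sup_near delta @[delta --> 0^'+]),
      (lim (inf_near delta @[delta --> 0^'+]) <= (integral_ba Omega mu f)%:E)%E &
      ((integral_ba Omega mu f)%:E <= lim (sup_near delta @[delta --> 0^'+]))%E].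
Proof.
move=> mOmega _ dmu f Lf inf_near sup_near.
have [bamu mu_ge0 _] := dmu; have [mf _] := Lf.
have fI : has_integral Omega mu f (integral_ba Omega mu f).
  by apply: getPex; exact: (has_integral_ex mOmega bamu mu_ge0 Lf).
have infE : inf_near = (fun delta =>
    - ess_sup_on (open_nbhd C delta `&` Omega) (fun x => - f x)%R)%E.
  by apply/funext => e; exact: ess_inf_onN.
have cvgN := @ess_sup_near_cvg R n C Omega (fun x => - f x).
split.
- by rewrite infE; exact: is_cvgeN.
- exact: ess_sup_near_cvg.
- rewrite infE limeN// leeNl -EFinN.
  apply: (density_integral_le mOmega dmu); first exact: measurable_funN.
  exact: has_integralN.
- exact: (density_integral_le mOmega dmu mf fI).
Qed.
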